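(* Let $k\geq 2$ be an integer. There exists an integer $N=N(k)$ such that for every integer $n\geq N$ and every connected graph $G$ of order $n$ and diameter $d$: if $d<\dfrac{2n}{3(k+2)}$, then $$S_k(D(G))<S_k(D(P_n)).$$
   Context: All graphs are finite, simple, undirected and connected; the order of a graph is its number of vertices. For a connected graph $G$ with vertex set $\{v_1,\dots,v_n\}$, the distance $d_G(v_i,v_j)$ is the length of a shortest path from $v_i$ to $v_j$, and the diameter of $G$ is the maximum distance between any two vertices. The distance matrix $D(G)$ is the real symmetric $n\times n$ matrix whose $(i,j)$-entry is $d_G(v_i,v_j)$. Its eigenvalues, with multiplicity, are written $\lambda_1(D(G))\geq\lambda_2(D(G))\geq\cdots\geq\lambda_n(D(G))$, and $S_k(D(G))=\lambda_1(D(G))+\cdots+\lambda_k(D(G))$. $P_n$ is the path on $n$ vertices. The phrase ''$n$ is sufficiently large with respect to $k$'' is expressed by the existence of a threshold $N(k)$ depending only on $k$. *)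

(* Defs.v *)
From mathcomp Require Import all_boot all_order all_algebra.
From mathcomp Require Import spectral polyrcf complex.

Set Implicit Arguments.
Unset Strict Implicit.
Unset Printing Implicit Defensive.

Import Order.TTheory GRing.Theory Num.Theory.
Local Open Scope ring_scope.

Section Graphs.
Local Open Scope nat_scope.

Definition simple_graph (V : finType) (e : rel V) : Prop :=
  symmetric e /\ irreflexive e.

Definition connected_graph (V : finType) (e : rel V) : Prop :=
  forall x y : V, connect e x y.

Definition walk_of_length (V : finType) (e : rel V) (m : nat) (x y : V) : bool :=
  [exists p : m.-tuple V, path e x p && (last x p == y)].

(* The least length of a walk from x to y, necessarily less than #|V| when
   there is one (gdistP, gdist_min); the value is #|V| when y is unreachable
   from x. *)
Definition gdist (V : finType) (e : rel V) (x y : V) : nat :=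
  find (fun m => walk_of_length e m x y) (iota 0 #|V|).

Definition diameter (V : finType) (e : rel V) : nat :=
  \max_(x : V) \max_(y : V) gdist e x y.

Definition path_graph (n : nat) : rel 'I_n :=
  fun i j => (i.+1 == j :> nat) || (j.+1 == i :> nat).

Lemma walk_of_lengthP (V : finType) (e : rel V) m (x y : V) :
  reflect (exists p : seq V, [/\ path e x p, last x p = y & size p = m])
          (walk_of_length e m x y).
Proof.
apply: (iffP existsP) => [[p /andP[pth /eqP lst]]|[p [pth lst /eqP sz]]].
  by exists p; rewrite size_tuple.
by exists (Tuple sz); rewrite /= pth lst eqxx.
Qed.

Lemma gdist_min (V : finType) (e : rel V) (x : V) (p : seq V) :
  path e x p -> gdist e x (last x p) <= size p.
Proof.
move=> pth; rewrite /gdist leqNgt; apply/negP => lt_sz.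
have szV : size p < #|V|.
  by apply: (leq_trans lt_sz); rewrite (leq_trans (find_size _ _)) ?size_iota.
have := before_find 0 lt_sz; rewrite nth_iota // add0n => Nw.
suff : walk_of_length e (size p) x (last x p) by rewrite Nw.
by apply/(@walk_of_lengthP _ e (size p) x); exists p.
Qed.

Lemma gdistP (V : finType) (e : rel V) (x y : V) : connect e x y ->
  exists p : seq V, [/\ path e x p, last x p = y & size p = gdist e x y].
Proof.
move=> /connectP[p0 /shortenP[p pth up _] Ey].
suff /walk_of_lengthP : walk_of_length e (gdist e x y) x y by [].
pose P m := walk_of_length e m x y.
have szV : size p < #|V| by have := max_card [in x :: p]; rewrite (card_uniqP up).
have hasP : has P (iota 0 #|V|).
  apply/hasP; exists (size p); first by rewrite mem_iota.
  by apply/(@walk_of_lengthP _ e (size p) x); exists p.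
have := nth_find 0 hasP; rewrite nth_iota ?add0n //.
by rewrite -[X in _ < X](size_iota 0) -has_find.
Qed.

Lemma gdist_sym (V : finType) (e : rel V) (x y : V) :
  symmetric e -> gdist e x y = gdist e y x.
Proof.
move=> sym_e; apply: eq_find => m.
suff W (a b : V) : walk_of_length e m a b -> walk_of_length e m b a.
  by apply/idP/idP; apply: W.
move=> /walk_of_lengthP[p [pth <- <-]]; apply/walk_of_lengthP.
exists (rev (belast a p)); split; last by rewrite size_rev size_belast.
  by rewrite rev_path; under eq_path do rewrite sym_e.
by case: p {pth} => //= b' p; rewrite rev_cons last_rcons.
Qed.

Lemma path_graph_simple n : simple_graph (@path_graph n).
Proof.
split=> [i j|i]; rewrite /path_graph; first by rewrite orbC.
by rewrite orbb; apply/negbTE; rewrite neq_ltn ltnSn orbT.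
Qed.

End Graphs.

Arguments path_graph : clear implicits.

Definition distance_matrix (R : pzSemiRingType) (V : finType) (e : rel V) :
    'M[R]_#|V| :=
  \matrix_(i, j) (gdist e (enum_val i) (enum_val j))%:R.

Lemma distance_matrix_sym (R : pzSemiRingType) (V : finType) (e : rel V) :
  symmetric e -> (distance_matrix R e)^T = distance_matrix R e.
Proof. by move=> sym_e; apply/matrixP => i j; rewrite !mxE gdist_sym. Qed.

(* The real eigenvalues, in nonincreasing order, each repeated according to its
   multiplicity as a root of the characteristic polynomial; rootsR lists the
   distinct roots.  For a symmetric matrix this is the whole spectrum
   (eigenvalues_sym, size_eigenvalues_sym). *)
Definition eigenvalues (R : rcfType) (n : nat) (A : 'M[R]_n) : seq R :=
  sort >=%R (flatten [seq nseq (mup a (char_poly A)) a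
                     | a <- rootsR (char_poly A)]).

(* Meaningful for k <= n: entries past the end of the list count as 0. *)
Definition sum_largest_eigenvalues (R : rcfType) (k n : nat) (A : 'M[R]_n) : R :=
  \sum_(i < k) (eigenvalues A)`_i.

Lemma mem_rootsR (R : rcfType) (p : {poly R}) (a : R) :
  p != 0 -> (a \in rootsR p) = root p a.
Proof. by move=> p0; rewrite -roots_on_rootsR // in_itv. Qed.

Lemma mup_prod_XsubC (R : fieldType) (s : seq R) (a : R) :
  mup a (\prod_(b <- s) ('X - b%:P)) = count_mem a s.
Proof.
elim: s => [|b s IHs]; first by rewrite big_nil mupNroot // rootC oner_eq0.
rewrite big_cons mupM ?polyXsubC_eq0 ?monic_neq0 ?monic_prod_XsubC // IHs /=.
by rewrite -['X - _]expr1 mup_XsubCX; case: (b == a).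
Qed.

Lemma sorted_eigenvalues (R : rcfType) (n : nat) (A : 'M[R]_n) :
  sorted >=%R (eigenvalues A).
Proof. by apply: sort_sorted => x y; exact: le_total. Qed.

Lemma eigenvalues_split (R : rcfType) (n : nat) (A : 'M[R]_n) (s : seq R) :
  char_poly A = \prod_(a <- s) ('X - a%:P) -> perm_eq (eigenvalues A) s.
Proof.
move=> Es; rewrite /eigenvalues perm_sort.
apply/allP => a _ /=; apply/eqP.
have p0 : char_poly A != 0 by rewrite monic_neq0 ?char_poly_monic.
rewrite -[RHS]mup_prod_XsubC -Es count_flatten -map_comp.
under eq_map => b /= do rewrite count_nseq /=.
rewrite sumnE big_map.
have [ra|nra] := boolP (a \in rootsR (char_poly A)).
  rewrite (bigD1_seq a) ?uniq_roots //= eqxx mul1n big1 ?addn0 // => b.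
  by move/negbTE=> ->.
rewrite mupNroot -?mem_rootsR // big_seq big1 // => b bP.
by case: eqVneq nra => [<-|]; rewrite ?bP.
Qed.

Lemma char_poly_conj (R : comUnitRingType) (n : nat) (P A : 'M[R]_n) :
  P \in unitmx -> char_poly (invmx P *m A *m P) = char_poly A.
Proof.
move=> Pu; pose toP := map_mx (@polyC R).
have QP : toP n n (invmx P) *m toP n n P = 1%:M.
  by rewrite /toP -map_mxM mulVmx // map_mx1.
rewrite /char_poly.
have -> : char_poly_mx (invmx P *m A *m P) =
    toP n n (invmx P) *m char_poly_mx A *m toP n n P.
  rewrite /char_poly_mx mulmxBr mulmxBl !map_mxM /toP; congr (_ - _).
  by rewrite scalar_mxC -mulmxA [X in _ *m X]QP mulmx1.
by rewrite !det_mulmx mulrAC -det_mulmx QP det1 mul1r.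
Qed.

Lemma char_poly_sym_split (R : rcfType) (n : nat) (A : 'M[R]_n) : A^T = A ->
  exists s : seq R, char_poly A = \prod_(a <- s) ('X - a%:P).
Proof.
move=> Asym; pose f : {rmorphism R -> R[i]%C} := real_complex R.
pose B := map_mx f A.
have fR x : f x \is Num.real by rewrite complex_real.
have Bherm : B \is hermsymmx.
  apply: realsym_hermsym.
    by apply/is_hermitianmxP; rewrite expr0 scale1r map_mx_id // map_trmx Asym.
  by apply/mxOverP => i j; rewrite mxE.
have /hermitian_normalmx/orthomx_spectralP BE := Bherm.
have /mxOverP dR := hermitian_spectral_diag_real Bherm.
set d := spectral_diag B in BE dR; set P := spectralmx B in BE.
have pB : char_poly B = \prod_(i < n) ('X - (d 0 i)%:P).
  rewrite BE char_poly_conj ?spectral_unit // char_poly_trig ?diag_mx_is_trig //.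
  by apply: eq_bigr => i _; rewrite mxE eqxx mulr1n.
exists [seq complex.Re (d 0 i) | i <- enum 'I_n].
apply: (@map_inj_poly _ _ f) => //; first exact: complexI.
rewrite map_char_poly pB big_map big_enum rmorph_prod /=.
apply: eq_bigr => i _; rewrite map_polyXsubC; congr ('X - _%:P).
by rewrite [f _]RRe_real ?dR.
Qed.

Lemma eigenvalues_sym (R : rcfType) (n : nat) (A : 'M[R]_n) : A^T = A ->
  char_poly A = \prod_(a <- eigenvalues A) ('X - a%:P).
Proof.
move=> /char_poly_sym_split[s Es].
by rewrite (perm_big _ (eigenvalues_split Es)).
Qed.

Lemma size_eigenvalues_sym (R : rcfType) (n : nat) (A : 'M[R]_n) :
  A^T = A -> size (eigenvalues A) = n.
Proof.
move=> /eigenvalues_sym/(congr1 (fun p : {poly R} => size p)).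
by rewrite size_char_poly size_prod_XsubC => -[].
Qed.

(* Main.v *)
Require Import Defs.
From mathcomp Require Import all_boot all_order all_algebra.
From mathcomp Require Import reals sesquilinear spectral complex zify ring lra.

(** Write S_k for the sum of the k largest eigenvalues.

    Upper bound for G.  Every entry of D(G) is at most d, so the squares of the
    eigenvalues sum to tr D(G)^2 <= (n d)^2.  With t = 2n^2/(3(k+2)), the
    hypothesis on d says n d < t, and adding up 2 t a <= a^2 + t^2 over the k
    largest eigenvalues a gives 2 t S_k < (k+1) t^2, that is
      S_k(D(G)) < n^2 (k+1) / (3(k+2)) = n^2/3 - n^2/(3(k+2)).

    Lower bound for the path.  By the Ky Fan inequality
    ([trace_compression_le]), S_k(D) is at least the sum of x^T D x over any k
    orthonormal vectors x.  On the path, the normalized all-ones vector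
    contributes (n^2-1)/3, because the distances |i-j| sum to n(n^2-1)/3; the
    k-1 vectors (e_{2m} - e_{2m+1})/sqrt 2 are orthonormal, orthogonal to the
    all-ones vector, and contribute -1 each.  Hence
      S_k(D(P_n)) >= (n^2-1)/3 - (k-1)   as soon as n >= 2k-1.

    The lower bound exceeds the upper one once n^2/(3(k+2)) > k - 2/3, and
    n >= 3(k+2) is enough for that. *)

Set Implicit Arguments.
Unset Strict Implicit.
Unset Printing Implicit Defensive.

Import Order.TTheory GRing.Theory Num.Theory.
Local Open Scope ring_scope.
Local Open Scope sesquilinear_scope.

(** * Spectral bounds for real symmetric matrices *)

(** The diagonalization is over R[i], by a unitary matrix, but the diagonal is
    real and lists the real eigenvalues. *)
Lemma spectral_decomposition_sym (R : rcfType) (n : nat) (A : 'M[R]_n) :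
  A^T = A ->
  exists (P : 'M[R[i]]_n) (r : 'I_n -> R),
    [/\ P \is unitarymx,
        map_mx (real_complex R) A =
          P^t* *m diag_mx (\row_i (r i)%:C%C) *m P
      & perm_eq (eigenvalues A) [seq r i | i : 'I_n]].
Proof.
move=> Asym; pose f : {rmorphism R -> R[i]%C} := real_complex R.
have Bherm : map_mx f A \is hermsymmx.
  apply: realsym_hermsym; last first.
    by apply/mxOverP => i j; rewrite mxE /= complex_real.
  by apply/is_hermitianmxP; rewrite expr0 scale1r map_mx_id // map_trmx Asym.
have /hermitian_normalmx/orthomx_spectralP BE := Bherm.
have /mxOverP dR := hermitian_spectral_diag_real Bherm.
have := spectral_unitarymx (map_mx f A).
move: (spectral_diag _) (spectralmx _) BE dR => d P BE dR Pu.
have dE i : d 0 i = (complex.Re (d 0 i))%:C%C by rewrite RRe_real.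
exists P, (fun i => complex.Re (d 0 i)); split=> //.
  have -> : \row_i (complex.Re (d 0 i))%:C%C = d.
    by apply/rowP => i; rewrite mxE -dE.
  by rewrite -invmx_unitary.
apply: eigenvalues_split; apply: (@map_inj_poly _ _ f) => //.
  exact: complexI.
rewrite map_char_poly BE char_poly_conj ?unitarymx_unit //.
rewrite char_poly_trig ?diag_mx_is_trig // big_image rmorph_prod /=.
by apply: eq_bigr => i _; rewrite mxE eqxx mulr1n map_polyXsubC dE.
Qed.

Lemma sum_sqr_eigenvalues (R : rcfType) (n : nat) (A : 'M[R]_n) :
  A^T = A -> \sum_(a <- eigenvalues A) a ^+ 2 = \sum_i \sum_j A i j ^+ 2.
Proof.
move=> Asym; have [P [r [Pu AE eigA]]] := spectral_decomposition_sym Asym.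
have PP : P *m P^t* = 1%:M by apply/unitarymxP.
rewrite (perm_big _ eigA) big_image /=.
have -> : \sum_i \sum_j A i j ^+ 2 = \tr (A *m A).
  apply: eq_bigr => i _; rewrite mxE; apply: eq_bigr => j _.
  by rewrite -{3}Asym mxE expr2.
apply: (@complexI R); rewrite -[RHS]/(real_complex R _) -trace_map_mx map_mxM AE.
rewrite [_%:C%C]rmorph_sum /=.
rewrite -!mulmxA [P *m (_ *m _)]mulmxA PP mul1mx mxtrace_mulC -!mulmxA PP mulmx1.
rewrite mul_diag_mx; apply: eq_bigr => i _; rewrite !mxE eqxx mulr1n.
by rewrite -rmorphM expr2.
Qed.

(** Compressing A to k orthonormal vectors (the rows of X) replaces the trace
    by a weighted sum of the eigenvalues, with weights in [0, 1] of total
    weight k. *)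
Lemma trace_compression_weights (R : rcfType) (k n : nat) (A : 'M[R]_n)
    (X : 'M[R]_(k, n)) :
  A^T = A -> X *m X^T = 1%:M ->
  exists r w : 'I_n -> R,
    [/\ perm_eq (eigenvalues A) [seq r i | i : 'I_n],
        forall i, 0 <= w i <= 1,
        \sum_i w i = k%:R
      & \tr (X *m A *m X^T) = \sum_i r i * w i].
Proof.
move=> Asym XX; have [P [r [Pu AE eigA]]] := spectral_decomposition_sym Asym.
have PP : P^t* *m P = 1%:M.
  by rewrite -invmx_unitary // mulVmx // unitarymx_unit.
pose f : {rmorphism R -> R[i]%C} := real_complex R.
pose Xc := map_mx f X; pose Y := Xc *m P^t*; pose Z := Y^t* *m Y.
have XcT : Xc^t* = map_mx f X^T.
  by apply/matrixP => i j; rewrite !mxE; rewrite conj_Creal // complex_real.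
have YcT : Y^t* = P *m Xc^t*.
  rewrite /Y trmx_mul map_mxM; congr (_ *m _).
  by rewrite map_trmx trmxK -map_mx_comp map_mx_id // => x; exact: conjCK.
(* Y has orthonormal rows, so Z = Y^* Y is an orthogonal projection of rank k;
   the weights are its diagonal entries. *)
have YY : Y *m Y^t* = 1%:M.
  by rewrite YcT mulmxA -[_ *m _ *m P]mulmxA PP mulmx1 XcT -map_mxM XX map_mx1.
have ZZ : Z *m Z = Z by rewrite /Z mulmxA -[_ *m _ *m Y^t*]mulmxA YY mulmx1.
have Zherm i j : Z j i = (Z i j)^*.
  rewrite !mxE rmorph_sum; apply: eq_bigr => l _ /=.
  by rewrite !mxE rmorphM /= conjCK mulrC.
have Zdiag i : Z i i = \sum_j `|Z i j| ^+ 2.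
  rewrite -{1}ZZ mxE; apply: eq_bigr => j _.
  by rewrite (Zherm i j) normCK.
have Z0 i : 0 <= Z i i.
  by rewrite Zdiag; apply: sumr_ge0 => j _; rewrite exprn_ge0.
have ZE i : Z i i = (complex.Re (Z i i))%:C%C by rewrite RRe_real // ger0_real.
exists r, (fun i => complex.Re (Z i i)); split=> //.
- move=> i; rewrite -!lecR -ZE Z0 /=.
  (* A diagonal entry z of a projection is the squared norm of its row, so it
     satisfies z ^ 2 <= z. *)
  have : Z i i ^+ 2 <= Z i i.
    rewrite {2}Zdiag (bigD1 i) //= ger0_norm // lerDl.
    by apply: sumr_ge0 => j _; rewrite exprn_ge0.
  have [->//|Zn0] := eqVneq (Z i i) 0.
  by rewrite expr2 ger_pMr // lt_def Zn0 Z0.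
- apply: (@complexI R); rewrite [LHS](rmorph_sum f) rmorph_nat.
  rewrite -[RHS](@mxtrace1 _ k) -YY mxtrace_mulC.
  by apply: eq_bigr => i _; rewrite [RHS]ZE.
- apply: (@complexI R); rewrite -[LHS]/(f _) -trace_map_mx !map_mxM -XcT -/Xc.
  rewrite [map_mx f A]AE [RHS](rmorph_sum f).
  transitivity (\tr (Y *m diag_mx (\row_i (r i)%:C%C) *m Y^t*)).
    by rewrite YcT /Y !mulmxA.
  rewrite mxtrace_mulC mulmxA -/Z mul_mx_diag; apply: eq_bigr => i _.
  rewrite mxE [X in _ * X]mxE [RHS]rmorphM /= -ZE.
  exact: mulrC.
Qed.

Lemma sum_nth_le_sum (R : numDomainType) (s : seq R) (k : nat) (F : R -> R) :
  (forall a, 0 <= F a) -> (k <= size s)%N ->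
  \sum_(i < k) F s`_i <= \sum_(a <- s) F a.
Proof.
move=> F0 ks; rewrite (big_nth 0) big_mkord.
rewrite (big_ord_widen _ (fun i => F s`_i) ks).
by rewrite [leRHS](bigID (fun i : 'I__ => (i < k)%N)) /= lerDl sumr_ge0.
Qed.

(** The Ky Fan inequality. *)
Lemma trace_compression_le (R : rcfType) (k n : nat) (A : 'M[R]_n)
    (X : 'M[R]_(k, n)) :
  A^T = A -> X *m X^T = 1%:M ->
  \tr (X *m A *m X^T) <= sum_largest_eigenvalues k A.
Proof.
move=> Asym XX.
have kn : (k <= n)%N.
  rewrite -[leqLHS](@mxrank1 R) -XX.
  exact: leq_trans (mxrankM_maxl _ _) (rank_leq_col _).
have [r [w [eigA w01 sum_w ->]]] := trace_compression_weights Asym XX.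
case: k kn sum_w {X XX} => [|k] kn sum_w.
  have w0 i : w i = 0.
    have /psumr_eq0P := sum_w; apply=> // j _; by case/andP: (w01 j).
  rewrite /sum_largest_eigenvalues big_ord0 big1 // => i _.
  by rewrite w0 mulr0.
(* Let c be the smallest of the k.+1 largest eigenvalues.  After subtracting
   c * k.+1, the sum of the positive parts of a - c over all eigenvalues a lies
   between the two sides. *)
set s := eigenvalues A; pose c := s`_k.
have szs : size s = n by rewrite size_eigenvalues_sym.
pose F (a : R) := Num.max (a - c) 0.
have geT : transitive (>=%R : rel R) by move=> x y z xy yz; exact: le_trans yz xy.
have s_mono (i j : nat) : (i <= j < n)%N -> s`_j <= s`_i.
  move=> /andP[ij jn].
  apply: (sorted_leq_nth geT (@lexx _ R) 0 (sorted_eigenvalues A)) => //.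
    by rewrite inE szs (leq_ltn_trans ij).
  by rewrite inE szs.
have le1 : \sum_i (r i - c) * w i <= \sum_(a <- s) F a.
  rewrite (perm_big _ eigA) big_image; apply: ler_sum => i _.
  have /andP[w0 w1] := w01 i; rewrite /F; case: (leP (r i - c) 0) => h.
    by rewrite mulr_le0_ge0.
  by rewrite ler_piMr // ltW.
have le2 : \sum_(a <- s) F a <= \sum_(i < k.+1) (s`_i - c).
  rewrite (big_nth 0) big_mkord szs (bigID (fun i : 'I__ => (i < k.+1)%N)) /=.
  rewrite [X in _ + X]big1 ?addr0 => [|i]; last first.
    rewrite -leqNgt => ki; rewrite /F; apply/max_idPr.
    by rewrite subr_le0 s_mono // (ltnW ki) ltn_ord.
  rewrite -(big_ord_widen _ (fun i => F s`_i)) //; apply: ler_sum => i _.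
  rewrite ge_max lexx subr_ge0 s_mono // kn andbT.
  by rewrite -ltnS ltn_ord.
move: (le_trans le1 le2).
under eq_bigr do rewrite mulrBl.
by rewrite !sumrB -mulr_sumr sum_w sumr_const card_ord mulr_natr lerD2r.
Qed.

Lemma sum_largest_eigenvalues_le (R : rcfType) (k n : nat) (A : 'M[R]_n) (t : R) :
  A^T = A -> 0 < t -> (k <= n)%N ->
  2 * t * sum_largest_eigenvalues k A <=
    \sum_i \sum_j A i j ^+ 2 + k%:R * t ^+ 2.
Proof.
move=> Asym t0 kn; rewrite -sum_sqr_eigenvalues //.
have := @sum_nth_le_sum R (eigenvalues A) k (fun a => a ^+ 2) (@sqr_ge0 R).
rewrite size_eigenvalues_sym // => /(_ kn) le_sq.
have -> : k%:R * t ^+ 2 = \sum_(i < k) t ^+ 2.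
  by rewrite sumr_const card_ord mulr_natl.
apply: le_trans (lerD le_sq (lexx _)).
rewrite -big_split mulr_sumr; apply: ler_sum => i _ /=.
rewrite -subr_ge0; have := sqr_ge0 ((eigenvalues A)`_i - t); nra.
Qed.

(** * The distance matrix of the path *)

(** With truncated subtraction, (j - i) + (i - j) is the distance |i - j|. *)
Lemma path_graph_walk_size_ge n (x : 'I_n) (p : seq 'I_n) :
  path (path_graph n) x p -> ((last x p - x) + (x - last x p) <= size p)%N.
Proof.
elim: p x => [|y p IHp] x /=; first by rewrite subnn.
by case/andP=> /orP[/eqP xy|/eqP xy] /IHp; lia.
Qed.

Lemma path_graph_gdist_ge n (x y : 'I_n) :
  ((y - x) + (x - y) <= gdist (path_graph n) x y)%N.
Proof.
rewrite leqNgt; apply/negP => lt_d.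
have szn : (gdist (path_graph n) x y < n)%N.
  by have := ltn_ord x; have := ltn_ord y; lia.
pose P m := walk_of_length (path_graph n) m x y.
have hasP : has P (iota 0 #|'I_n|) by rewrite has_find size_iota [ltnRHS]card_ord.
have := nth_find 0%N hasP; rewrite nth_iota ?add0n; last first.
  by rewrite [ltnRHS]card_ord.
move=> /walk_of_lengthP[p [/path_graph_walk_size_ge le_sz lastp szp]].
by move: le_sz; rewrite lastp szp leqNgt lt_d.
Qed.

Lemma gdist_le1 (V : finType) (e : rel V) (x y : V) :
  e x y -> (gdist e x y <= 1)%N.
Proof. by move=> exy; apply: (@gdist_min V e x [:: y]); rewrite /= exy. Qed.

Lemma sum_absdiff n :
  (3 * (\sum_(i < n) \sum_(j < n) ((j - i) + (i - j))) + n = n ^ 3)%N.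
Proof.
have tri m : (2 * \sum_(i < m) (m - i) = m * m.+1)%N.
  elim: m => [|m IHm]; first by rewrite big_ord0.
  rewrite big_ord_recl; under eq_bigr do rewrite lift0 subSS.
  by rewrite mulnDr IHm /=; lia.
elim: n => [|n IHn]; first by rewrite big_ord0.
rewrite big_ord_recr /=; under eq_bigr do rewrite big_ord_recr /=.
rewrite big_split big_ord_recr /=.
have E1 : (\sum_(i < n) ((n - i) + (i - n)) = \sum_(i < n) (n - i))%N.
  by apply: eq_bigr => i _; have := ltn_ord i; lia.
have E2 : (\sum_(i < n) ((i - n) + (n - i)) = \sum_(i < n) (n - i))%N.
  by apply: eq_bigr => i _; have := ltn_ord i; lia.
rewrite E1 E2 subnn; move: IHn (tri n); rewrite !expnS !expn0.
set S := (\sum_(i < n) \sum_(j < n) _)%N; set T := (\sum_(i < n) _)%N.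
nia.
Qed.

(** The Ky Fan inequality for a distance matrix, with the orthonormal vectors
    given as functions on the vertices. *)
Lemma sum_gdist_form_le (R : rcfType) (V : finType) (e : rel V) (k : nat)
    (F : 'I_k -> V -> R) :
  symmetric e -> (forall i j, \sum_v F i v * F j v = (i == j)%:R) ->
  \sum_i \sum_u \sum_v F i u * (gdist e u v)%:R * F i v <=
    sum_largest_eigenvalues k (distance_matrix R e).
Proof.
move=> sym_e FF; pose X := \matrix_(i < k, j < #|V|) F i (enum_val j).
have XX : X *m X^T = 1%:M.
  apply/matrixP => i j; rewrite !mxE -FF [RHS]big_enum_val.
  by apply: eq_bigr => l _; rewrite !mxE.
apply: le_trans (trace_compression_le (distance_matrix_sym _ sym_e) XX).
rewrite le_eqVlt; apply/orP; left; apply/eqP/eq_bigr => i _.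
rewrite mxE exchange_big [LHS]big_enum_val; apply: eq_bigr => l _.
rewrite !mxE mulr_suml [LHS]big_enum_val; apply: eq_bigr => m _.
by rewrite !mxE.
Qed.

(** The orthonormal vectors tested on the path with n.+1 vertices: the
    normalized all-ones vector at index 0, and (e_{2m} - e_{2m+1})/sqrt 2 at
    index m.+1.  The vertices 2m and 2m+1 are given by [inord], which is only
    faithful for 2m+1 <= n. *)
Definition path_test_vector (R : rcfType) (n i : nat) (v : 'I_n.+1) : R :=
  if i is m.+1 then
    ((v == inord m.*2)%:R - (v == inord m.*2.+1)%:R) / Num.sqrt 2
  else (Num.sqrt n.+1%:R)^-1.

Lemma sum_path_test_vectorS (R : rcfType) n m (G : 'I_n.+1 -> R) :
  \sum_v path_test_vector R m.+1 v * G v =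
    (G (inord m.*2) - G (inord m.*2.+1)) / Num.sqrt 2.
Proof.
have sum1 (a : 'I_n.+1) : \sum_v (v == a)%:R * G v = G a.
  rewrite (bigD1 a) //= eqxx mul1r big1 ?addr0 // => v /negbTE ->.
  by rewrite mul0r.
rewrite -[X in X - _]sum1 -[X in _ - X]sum1 -sumrB mulr_suml.
by apply: eq_bigr => v _; rewrite /= mulrAC -mulrBl.
Qed.

Lemma path_test_vector_orthonormal (R : rcfType) n k : (k.*2 <= n.+2)%N ->
  forall i j : 'I_k,
    \sum_v path_test_vector R i v * path_test_vector R j (v : 'I_n.+1) =
      (i == j)%:R.
Proof.
move=> kn i j; have := ltn_ord i; have := ltn_ord j.
rewrite -[i == j]/(i == j :> nat); case: (nat_of_ord i) => [|m].
  case: (nat_of_ord j) => [|m'] jk _ /=.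
    rewrite sumr_const card_ord -[LHS]mulr_natl -invfM -expr2.
    by rewrite sqr_sqrtr ?ler0n // divff ?pnatr_eq0.
  under eq_bigr do rewrite mulrC.
  by rewrite sum_path_test_vectorS subrr mul0r.
move=> jk ik; rewrite sum_path_test_vectorS.
case: (nat_of_ord j) jk => [|m'] jk; first by rewrite subrr mul0r.
rewrite /= -!val_eqE /= !inordK; [|lia..].
have -> : (m.*2 == m'.*2.+1)%N = false by lia.
have -> : (m.*2.+1 == m'.*2)%N = false by lia.
have -> : (m.*2.+1 == m'.*2.+1)%N = (m == m')%N by lia.
have -> : (m.*2 == m'.*2)%N = (m == m')%N by lia.
rewrite eqSS -mulrBl -mulrA -invfM -expr2 sqr_sqrtr ?ler0n //.
by rewrite subr0 sub0r opprK -mulr2n -[_ *+ 2]mulr_natr mulfK ?pnatr_eq0.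
Qed.

Lemma sum_largest_eigenvalues_path_ge (R : rcfType) (n k : nat) :
  (k.*2.+2 <= n.+2)%N ->
  (n.+1%:R ^+ 2 - 1) / 3 - k%:R <=
    sum_largest_eigenvalues k.+1 (distance_matrix R (path_graph n.+1)).
Proof.
move=> kn; have [sym_e _] := path_graph_simple n.+1.
have ortho := @path_test_vector_orthonormal R n k.+1 kn.
apply: le_trans (sum_gdist_form_le sym_e ortho).
rewrite big_ord_recl; apply: lerD => /=.
  have n0 : n.+1%:R != 0 :> R by rewrite pnatr_eq0.
  have sq : (Num.sqrt n.+1%:R)^-1 ^+ 2 = n.+1%:R^-1 :> R.
    by rewrite exprVn sqr_sqrtr.
  have -> : ((n.+1%:R ^+ 2 - 1) / 3 : R) =
      n.+1%:R^-1 * (\sum_(i < n.+1) \sum_(j < n.+1) ((j - i) + (i - j)))%N%:R.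
    have /(congr1 (fun m : nat => m%:R : R)) := sum_absdiff n.+1.
    rewrite natrD natrM natrX => E; apply: (mulfI n0); rewrite mulVKf //.
    lra.
  rewrite natr_sum mulr_sumr; apply: ler_sum => u _.
  rewrite natr_sum mulr_sumr; apply: ler_sum => v _.
  rewrite mulrAC -expr2 sq ler_wpM2l ?invr_ge0 // ler_nat.
  exact: path_graph_gdist_ge.
have -> : - k%:R = \sum_(i < k) (-1 : R).
  by rewrite sumr_const card_ord mulNrn.
apply: ler_sum => i _; have ik := ltn_ord i.
(* The m-th difference vector, with a = 2m and b = 2m+1, gives
   (D a a - D b a - (D a b - D b b)) / 2 >= - D a b. *)
under eq_bigr => u _.
  under eq_bigr do rewrite -mulrA.
  rewrite -mulr_sumr; under eq_bigr do rewrite mulrC.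
  rewrite sum_path_test_vectorS.
  over.
rewrite sum_path_test_vectorS -mulrBl -mulrA -invfM -expr2 sqr_sqrtr ?ler0n //.
set a : 'I_n.+1 := inord _; set b : 'I_n.+1 := inord _.
have eab : path_graph n.+1 a b by rewrite /path_graph !inordK ?eqxx //; lia.
have : (gdist (path_graph n.+1) a b)%:R <= 1 :> R by rewrite lern1 gdist_le1.
rewrite (gdist_sym b a sym_e).
have := ler0n R (gdist (path_graph n.+1) a a).
have := ler0n R (gdist (path_graph n.+1) b b).
lra.
Qed.

(** * Comparison with the path *)

Lemma sum_sqr_distance_matrix_le (R : rcfType) (V : finType) (e : rel V) :
  \sum_i \sum_j distance_matrix R e i j ^+ 2 <= (#|V|%:R * (diameter e)%:R) ^+ 2.
Proof.
rewrite exprMn [#|V|%:R ^+ 2]expr2 -mulrA.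
have sumc (c : R) : \sum_(i < #|V|) c = #|V|%:R * c.
  by rewrite sumr_const card_ord mulr_natl.
rewrite -!sumc; apply: ler_sum => i _; apply: ler_sum => j _.
rewrite mxE ler_pXn2r ?nnegrE ?ler0n // ler_nat.
apply: leq_trans (leq_bigmax (enum_val i)).
exact: (leq_bigmax (F := fun y => gdist e (enum_val i) y)).
Qed.

Theorem proposition1 (R : realType) (k : nat) (hk : (2 <= k)%N) :
  exists N : nat, forall n : nat, (N <= n)%N ->
    forall (V : finType) (e : rel V),
      simple_graph e -> connected_graph e -> #|V| = n ->
      (diameter e)%:R < (2 * n%:R) / (3 * (k%:R + 2)) :> R ->
      sum_largest_eigenvalues k (distance_matrix R e) <
        sum_largest_eigenvalues k (distance_matrix R (path_graph n)).
Proof.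
exists (3 * (k + 2))%N => n Nn V e [sym_e _] _ cardV diam_lt.
have k2 : 0 < k%:R + 2 :> R by rewrite ltr_wpDl.
have NnR : 3 * (k%:R + 2) <= n%:R :> R by rewrite -natrD -natrM ler_nat.
have n0 : 0 < n%:R :> R by apply: lt_le_trans NnR; rewrite mulr_gt0.
set S := sum_largest_eigenvalues k (distance_matrix R e).
have lower : (n%:R ^+ 2 - 1) / 3 - (k%:R - 1) <=
    sum_largest_eigenvalues k (distance_matrix R (path_graph n)).
  case: n k hk Nn {diam_lt cardV NnR n0 k2 S} => [|n] [|k] // _ Nn.
  by rewrite -[k.+1%:R]natr1 addrK; apply: sum_largest_eigenvalues_path_ge; lia.
apply: lt_le_trans lower.
(* The t of the upper bound is 2 q. *)
pose q : R := n%:R ^+ 2 / (3 * (k%:R + 2)).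
have q0 : 0 < q by rewrite divr_gt0 ?exprn_gt0 ?mulr_gt0.
have nd_lt : n%:R * (diameter e)%:R < 2 * q.
  by rewrite /q expr2 -!mulrA mulrCA ltr_pM2l // mulrA.
have sq_lt : \sum_i \sum_j distance_matrix R e i j ^+ 2 < (2 * q) ^+ 2.
  apply: le_lt_trans (sum_sqr_distance_matrix_le _ _) _.
  have nd0 : 0 <= n%:R * (diameter e)%:R :> R by rewrite mulr_ge0.
  by rewrite cardV ltr_pXn2r ?nnegrE // (le_trans nd0) ?ltW.
have kV : (k <= #|V|)%N by rewrite cardV; lia.
have := @sum_largest_eigenvalues_le R k _ _ (2 * q) (distance_matrix_sym R sym_e).
rewrite -/S mulr_gt0 // => /(_ isT kV) upper.
have S_lt : S < q * (k%:R + 1).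
  move: sq_lt upper; set X := \sum_i _; clearbody X q S => sq_lt upper.
  have : (4 * q) * S < (4 * q) * (q * (k%:R + 1)) by nra.
  by rewrite ltr_pM2l // mulr_gt0.
have qE : q * (k%:R + 2) = n%:R ^+ 2 / 3.
  by rewrite /q; field; rewrite gt_eqF.
have q_ge : 3 * (k%:R + 2) <= q.
  rewrite /q ler_pdivlMr ?mulr_gt0 // -expr2 ler_pXn2r ?nnegrE //.
  by rewrite mulr_ge0 // ltW.
lra.
Qed.
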